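(* Let $\mathcal{M}^I_m$ be a timelike first kind meridian surface of hyperbolic type in $\mathbb{R}^4_1$, parametrized by $z(u,v)=f(u)\,l(v)+g(u)\,e_1$, $u\in I$, $v\in J$. Then $\mathcal{M}^I_m$ has constant non-zero Gauss curvature $K$ if and only if the meridian curve $m:u\mapsto(f(u),g(u))$ is given by $$f(u)=a_1\sin(\sqrt{K}\,u)+a_2\cos(\sqrt{K}\,u)\quad\text{if }K>0,$$ $$f(u)=a_1\sinh(\sqrt{-K}\,u)+a_2\cosh(\sqrt{-K}\,u)\quad\text{if }K<0,$$ where $a_1,a_2$ are constants and the function $g(u)$ is determined by $\dot g(u)=\pm\sqrt{1-\dot f^2(u)}$.
   Context: $\mathbb{R}^4_1$ is the Minkowski 4-space with metric $\langle\cdot,\cdot\rangle = dx_1^2+dx_2^2+dx_3^2-dx_4^2$ and standard orthonormal frame $e_1,e_2,e_3,e_4$ ($e_4$ timelike). $\mathbb{S}^2_1(1)=\{V\in\mathrm{span}\{e_2,e_3,e_4\}:\langle V,V\rangle=1\}$. A first kind meridian surface of hyperbolic type is the surface $z(u,v)=f(u)l(v)+g(u)e_1$, where $I,J\subset\mathbb{R}$ are intervals, $f,g:I\to\mathbb{R}$ are smooth with $f>0$, and $l:J\to\mathbb{S}^2_1(1)$ is a smooth timelike curve with $\langle l',l'\rangle=-1$ (prime $=d/dv$). The meridian curve is parametrized by arc length: $\dot f^2+\dot g^2=1$ (dot $=d/du$). The induced metric is $du^2-f(u)^2dv^2$; the Gauss curvature is that of this Lorentzian metric, $K=\dfrac{\langle\sigma(X,X),\sigma(Y,Y)\rangle-\langle\sigma(X,Y),\sigma(X,Y)\rangle}{\langle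 X,X\rangle\langle Y,Y\rangle-\langle X,Y\rangle^2}$, with $\sigma$ the second fundamental form. *)

(* Defs.v *)
From HB Require Import structures.
From mathcomp Require Import all_boot all_order all_algebra.
From mathcomp Require Import all_classical all_reals all_analysis.

Set Implicit Arguments.
Unset Strict Implicit.
Unset Printing Implicit Defensive.

Import Order.TTheory GRing.Theory Num.Theory.
Import numFieldNormedType.Exports.

Local Open Scope classical_set_scope.
Local Open Scope ring_scope.

Definition sinh (R : realType) (x : R) : R := (expR x - expR (- x)) / 2.
Definition cosh (R : realType) (x : R) : R := (expR x + expR (- x)) / 2.

Definition nondegenerate_interval (R : realType) (I : set R) : Prop :=
  is_interval I /\ exists x y, [/\ I x, I y & x < y].

(* Smoothness on an arbitrary, not necessarily open, interval: [h] is C^oo on a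
   neighbourhood of every point of [I]. A map defined only on [I] and smooth
   there is represented by any smooth extension; the derivatives at points of a
   nondegenerate interval [I] do not depend on the extension. *)
Definition smooth_on (R : realType) (V : normedModType R) (I : set R)
    (h : R -> V) : Prop :=
  forall x, I x ->
    \forall y \near x, forall n, derivable (derive1n n h) y 1.

Section Minkowski.
Variable R : realType.
Implicit Types x y V : 'rV[R]_4.

(* Indices are shifted by one: [x 0 i] is the coordinate x_(i+1),
   so the time coordinate x_4 is [x 0 3]. *)
Definition mink x y : R :=
  x 0 0 * y 0 0 + x 0 1 * y 0 1 + x 0 2 * y 0 2 - x 0 3 * y 0 3.

Definition e1 : 'rV[R]_4 := delta_mx 0 0.
Definition e2 : 'rV[R]_4 := delta_mx 0 1.
Definition e3 : 'rV[R]_4 := delta_mx 0 2.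
Definition e4 : 'rV[R]_4 := delta_mx 0 3.

Definition deSitter2 : set 'rV[R]_4 :=
  [set V | (exists a b c : R, V = a *: e2 + b *: e3 + c *: e4) /\
           mink V V = 1].

End Minkowski.

Section Surface.
Variables (R : realType) (z : R -> R -> 'rV[R]_4).

Definition du (u v : R) : 'rV[R]_4 := derive1 (fun s => z s v) u.
Definition dv (u v : R) : 'rV[R]_4 := derive1 (fun t => z u t) v.
Definition duu (u v : R) : 'rV[R]_4 := derive1 (fun s => du s v) u.
Definition duv (u v : R) : 'rV[R]_4 := derive1 (fun t => du u t) v.
Definition dvv (u v : R) : 'rV[R]_4 := derive1 (fun t => dv u t) v.

(* A pair [X] stands for the tangent vector X.1 z_u + X.2 z_v. *)
Definition tangent (u v : R) (X : R * R) : 'rV[R]_4 :=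
  X.1 *: du u v + X.2 *: dv u v.

Definition first_form (u v : R) (X Y : R * R) : R :=
  mink (tangent u v X) (tangent u v Y).

Definition gram_det (u v : R) (X Y : R * R) : R :=
  first_form u v X X * first_form u v Y Y - first_form u v X Y ^+ 2.

(* The tangential part p z_u + q z_v of [w] is obtained by solving
   p E + q F = <w, z_u>, p F + q G = <w, z_v>, which is possible wherever the
   induced metric is nondegenerate (E G - F^2 <> 0). *)
Definition normal_part (u v : R) (w : 'rV[R]_4) : 'rV[R]_4 :=
  let E := mink (du u v) (du u v) in
  let F := mink (du u v) (dv u v) in
  let G := mink (dv u v) (dv u v) in
  let wu := mink w (du u v) in
  let wv := mink w (dv u v) in
  let D := E * G - F ^+ 2 in
  w - (((wu * G - wv * F) / D) *: du u v + ((wv * E - wu * F) / D) *: dv u v).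

(* sigma(X, Y): the normal part of the flat derivative of Y along X. *)
Definition second_form (u v : R) (X Y : R * R) : 'rV[R]_4 :=
  normal_part u v
    ((X.1 * Y.1) *: duu u v + (X.1 * Y.2 + X.2 * Y.1) *: duv u v
     + (X.2 * Y.2) *: dvv u v).

(* The quotient below does not depend on the basis X, Y of the tangent plane;
   the coordinate basis z_u, z_v is used. *)
Definition gauss_curvature (u v : R) : R :=
  let X := (1, 0) in
  let Y := (0, 1) in
  (mink (second_form u v X X) (second_form u v Y Y)
   - mink (second_form u v X Y) (second_form u v X Y)) / gram_det u v X Y.

End Surface.

Definition meridian_param (R : realType) (f g : R -> R) (l : R -> 'rV[R]_4)
    (u v : R) : 'rV[R]_4 :=
  f u *: l v + g u *: e1 R.

(* The induced metric is then du^2 - f^2 dv^2, so that the surface is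
   automatically timelike. *)
Record meridian_surface_hyp1 (R : realType) (I J : set R) (f g : R -> R)
    (l : R -> 'rV[R]_4) : Prop := {
  msh_I : nondegenerate_interval I;
  msh_J : nondegenerate_interval J;
  msh_f_smooth : smooth_on I f;
  msh_g_smooth : smooth_on I g;
  msh_l_smooth : smooth_on J l;
  msh_f_gt0 : forall u, I u -> 0 < f u;
  msh_arclength : forall u, I u -> derive1 f u ^+ 2 + derive1 g u ^+ 2 = 1;
  msh_l_deSitter : forall v, J v -> deSitter2 (l v);
  msh_l_timelike : forall v, J v -> mink (derive1 l v) (derive1 l v) = -1 }.

(* Main.v *)
Require Import Defs.
From HB Require Import structures.
From mathcomp Require Import all_boot all_order all_algebra.
From mathcomp Require Import all_classical all_reals all_analysis.
From mathcomp Require Import ring lra.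
Import Order.TTheory GRing.Theory Num.Theory.
Import numFieldNormedType.Exports.
Local Open Scope classical_set_scope.
Local Open Scope ring_scope.

(** Along the surface z = f l + g e1 the coordinate frame is orthogonal, with
    z_u = f' l + g' e1 of square 1 and z_v = f l' of square - f^2.  The vectors
    l, l', l'' have no e1-component, and differentiating <l, l> = 1 and
    <l', l'> = -1 gives <l, l'> = 0, <l, l''> = 1 and <l', l''> = 0; likewise
    f'^2 + g'^2 = 1 gives f' f'' + g' g'' = 0.  Inserting these values into the
    definition of the curvature leaves K = - f'' / f
    ([gauss_curvature_frame], [meridian_curvature]).

    Since f > 0, constant curvature K therefore means f'' = - K f on I.
    The functions S, C = sin, cos (or sinh, cosh) of sqrt |K| u satisfy
    S' = w C, C' = - s w S and s S^2 + C^2 = 1 with K = s w^2 and s = 1 (or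
    s = -1), and both signs of K are treated at once in terms of these
    relations.  Variation of constants writes f = A S + B C, with A and B
    explicit in f and f' and constant on I ([oscillator_solution]); conversely
    such a combination satisfies f'' = - K f ([oscillator_derive2]).

    It remains to see that one sign in g' = +-sqrt (1 - f'^2) serves for the
    whole interval.  As K <> 0 and f > 0, f'' = - K f never vanishes and has a
    fixed sign, so f' is strictly monotone with values in [-1, 1] and can reach
    1 or -1 only at an endpoint of I.  Hence g' has no zero inside I, and by the
    intermediate value theorem it does not change sign
    ([derivable_constant_sign]).

    The intervals may contain their endpoints, where the identities above hold
    on one side only while the derivatives are two-sided derivatives of an
    extension; [derive_eq_on] lets such identities be differentiated there. *)

Set Implicit Arguments.
Unset Strict Implicit.
Unset Printing Implicit Defensive.

(** * Derivatives of vector-valued maps *)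

Lemma is_derive_derive1 (R : realType) (V : normedModType R) (h : R -> V)
    (x : R) :
  derivable h x 1 -> is_derive x 1 h (derive1 h x).
Proof. by move=> ?; rewrite derive1E; exact: derivableP. Qed.

Lemma derive1_val (R : realType) (V : normedModType R) (h : R -> V) (x : R) d :
  is_derive x 1 h d -> derive1 h x = d.
Proof. by move=> ?; rewrite derive1E derive_val. Qed.

Lemma is_derive_mx (R : realType) m n (M : R -> 'M[R]_(m, n)) (x : R) dM :
  is_derive x 1 M dM <-> forall i j, is_derive x 1 (fun t => M t i j) (dM i j).
Proof.
split=> [[dvM <-] i j|dv].
  rewrite derive_mx // mxE.
  by apply: derivableP; exact: (derivable_mxP M x 1).1.
have dvM : derivable M x 1 by apply/derivable_mxP => i j; have [] := dv i j.
apply: DeriveDef => //; rewrite derive_mx //; apply/matrixP => i j.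
by rewrite mxE; have [] := dv i j.
Qed.

Lemma is_derive_scale (R : realType) m n (f : R -> R) (l : R -> 'M[R]_(m, n))
    (x : R) df dl :
  is_derive x 1 f df -> is_derive x 1 l dl ->
  is_derive x 1 (fun t => f t *: l t) (df *: l x + f x *: dl).
Proof.
move=> hf /is_derive_mx hl; apply/is_derive_mx => i j.
under eq_fun do rewrite mxE.
have h := is_deriveM hf (hl i j).
by apply: (is_derive_eq h); rewrite !mxE /GRing.scale /=; ring.
Qed.

Lemma is_derive_mink (R : realType) (p q : R -> 'rV[R]_4) (x : R) dp dq :
  is_derive x 1 p dp -> is_derive x 1 q dq ->
  is_derive x 1 (fun t => mink (p t) (q t)) (mink dp (q x) + mink (p x) dq).
Proof.
move=> /is_derive_mx hp /is_derive_mx hq.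
pose c i : is_derive x 1 _ _ := is_deriveM (hp 0 i) (hq 0 i).
apply: (is_derive_eq (is_deriveB (is_deriveD (is_deriveD (c 0) (c 1)) (c 2))
  (c 3))).
by rewrite /mink /GRing.scale /=; ring.
Qed.

(** * Calculus on an arbitrary interval *)

(** At an endpoint of I only one side of x is controlled.  Composing
    with the affine path from x to another point y of I, traversed on [0, 1],
    makes every case a limit from the right at 0, where the difference quotient
    of h - k vanishes; the factor y - x that appears is nonzero. *)
Lemma derive_eq_on (R : realType) (I : set R) (h k : R -> R) (x a b : R) :
  nondegenerate_interval I -> I x ->
  (forall t, I t -> h t = k t) ->
  is_derive x 1 h a -> is_derive x 1 k b -> a = b.
Proof.
move=> [itvI [p [q [Ip Iq pq]]]] Ix hk ha kb.
have [y Iy yx] : exists2 y, I y & y != x.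
  have [->|px] := eqVneq x p; first by exists q; rewrite // gt_eqF.
  by exists p; rewrite // eq_sym.
pose c t := x + t * (y - x).
have dc : is_derive (0 : R) 1 c (y - x).
  have dl := is_deriveD (is_derive_cst x (0 : R) 1)
    (is_deriveM (is_derive_id (0 : R) 1) (is_derive_cst (y - x) (0 : R) 1)).
  apply: (is_derive_eq dl).
  by rewrite /GRing.scale /= /cst; ring.
have c0 : c 0 = x by rewrite /c mul0r addr0.
have Ic t : 0 <= t <= 1 -> I (c t).
  move=> /andP[t0 t1]; case: (leP x y) => xy.
    by apply: (itvI x y) => //; rewrite /c; apply/andP; split; nra.
  by apply: (itvI y x) => //; rewrite /c; apply/andP; split; nra.
rewrite -c0 in ha kb.
have dq := is_deriveB (is_derive1_comp ha dc) (is_derive1_comp kb dc).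
suff : a * (y - x) - b * (y - x) = 0.
  rewrite -mulrBl => /eqP; rewrite mulf_eq0 !subr_eq0 (negPf yx) orbF.
  by move/eqP.
move: dq => [dq <-].
rewrite -derive1E /derive1 cvg_at_rightE; last first.
  by move: dq; rewrite /derivable; under eq_fun do rewrite [_%:A]mulr1.
apply: cvg_lim => //; apply: cvg_near_cst.
near=> t.
have t01 : 0 <= t <= 1.
  by apply/andP; split; near: t; [exact: nbhs_right_ge|apply: nbhs_right_le].
have -> : (h \o c - (k \o c)) (t + 0) = 0.
  by rewrite addr0 fctE /= hk ?subrr //; exact: Ic.
have -> : (h \o c - (k \o c)) 0 = 0.
  by rewrite fctE /= hk ?subrr //; apply: Ic; rewrite lexx ler01.
by rewrite subrr scaler0.
Unshelve. all: by end_near. Qed.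

Lemma MVT_on (R : realType) (I : set R) (h dh : R -> R) (x y : R) :
  is_interval I -> (forall t, I t -> is_derive t 1 h (dh t)) ->
  I x -> I y -> x < y ->
  exists2 c, I c /\ x < c < y & h y - h x = dh c * (y - x).
Proof.
move=> itvI hd Ix Iy xy.
have Iin t : t \in `[x, y] -> I t by rewrite in_itv => xty; exact: (itvI x y).
have [||c cxy e] := @MVT R h dh x y xy.
- by move=> t /subset_itv_oo_cc /Iin /hd.
- apply: derivable_within_continuous => t /Iin /hd [].
  by [].
- exists c => //; split; first exact/Iin/subset_itv_oo_cc.
  by move: cxy; rewrite in_itv.
Qed.

Lemma derive0_const_on (R : realType) (I : set R) (h : R -> R) (x y : R) :
  is_interval I -> (forall t, I t -> is_derive t 1 h 0) ->
  I x -> I y -> h x = h y.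
Proof.
move=> itvI hd.
wlog xy : x y / x < y => [H Ix Iy|Ix Iy].
  by case: (ltgtP x y) => [xy|yx|->] //; [exact: H|symmetry; exact: H].
have [c _] := MVT_on itvI hd Ix Iy xy.
by rewrite mul0r => /eqP; rewrite subr_eq0 => /eqP.
Qed.

(** * The Minkowski product *)

Lemma minkC (R : realType) (x y : 'rV[R]_4) : mink x y = mink y x.
Proof. by rewrite /mink; ring. Qed.

Lemma minkDl (R : realType) (x y w : 'rV[R]_4) :
  mink (x + y) w = mink x w + mink y w.
Proof. by rewrite /mink !mxE; ring. Qed.

Lemma minkZl (R : realType) (a : R) (x w : 'rV[R]_4) :
  mink (a *: x) w = a * mink x w.
Proof. by rewrite /mink !mxE; ring. Qed.

Lemma minkDr (R : realType) (x y w : 'rV[R]_4) :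
  mink w (x + y) = mink w x + mink w y.
Proof. by rewrite !(minkC w) minkDl. Qed.

Lemma minkZr (R : realType) (a : R) (x w : 'rV[R]_4) :
  mink w (a *: x) = a * mink w x.
Proof. by rewrite !(minkC w) minkZl. Qed.

Lemma mink_e1 (R : realType) (x : 'rV[R]_4) : mink x (e1 R) = x 0 0.
Proof. by rewrite /mink /e1 !mxE /=; ring. Qed.

Lemma mink_e1e1 (R : realType) : mink (e1 R) (e1 R) = 1.
Proof. by rewrite mink_e1 /e1 !mxE. Qed.

(** * The curvature of a meridian surface *)

(** In orthogonal coordinates with <z_u, z_u> = 1 the normal part of w is
    w - <w, z_u> z_u - (<w, z_v> / G) z_v, so each product of normal parts is
    the ambient product minus the products of the tangential components. *)
Lemma gauss_curvature_orthogonal (R : realType) (z : R -> R -> 'rV[R]_4)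
    (u v : R) (p q a b c : 'rV[R]_4) (G : R) :
  du z u v = p -> dv z u v = q ->
  duu z u v = a -> duv z u v = b -> dvv z u v = c ->
  mink p p = 1 -> mink p q = 0 -> mink q q = G -> G != 0 ->
  gauss_curvature z u v =
    ((mink a c - mink a p * mink c p - mink a q * mink c q / G)
     - (mink b b - mink b p ^+ 2 - mink b q ^+ 2 / G)) / G.
Proof.
move=> Hu Hv Huu Huv Hvv pp pq qq G0.
rewrite /gauss_curvature /gram_det /second_form /first_form /tangent.
rewrite /normal_part Hu Hv Huu Huv Hvv pp pq qq.
have projE w : w - (((mink w p * G - mink w q * 0) / (1 * G - 0 ^+ 2)) *: p
      + ((mink w q * 1 - mink w p * 0) / (1 * G - 0 ^+ 2)) *: q) =
    w + (- mink w p) *: p + (- (mink w q / G)) *: q.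
  have -> : (mink w p * G - mink w q * 0) / (1 * G - 0 ^+ 2) = mink w p.
    by field.
  have -> : (mink w q * 1 - mink w p * 0) / (1 * G - 0 ^+ 2) = mink w q / G.
    by field.
  by rewrite opprD -!scaleNr addrA.
rewrite !projE /= !(mulr0, mul0r, mulr1) !scale0r !scale1r.
rewrite !addr0 !add0r !scale1r.
rewrite !(minkDl, minkDr, minkZl, minkZr) pp pq (minkC q p) pq qq.
rewrite (minkC p b) (minkC p c) (minkC q b) (minkC q c).
by field.
Qed.

(** The meridian surface at a single point, as pure algebra: L, L1, L2 stand
    for l, l', l'' and f0, f1, f2, g1, g2 for f, f', f'', g', g''.  The vector
    z_uv = f' l' is tangent, so only <z_uu, z_vv> contributes; its value f f''
    divided by - f^2 is the curvature. *)
Lemma gauss_curvature_frame (R : realType) (z : R -> R -> 'rV[R]_4) (u v : R)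
    (L L1 L2 : 'rV[R]_4) (f0 f1 f2 g1 g2 : R) :
  mink L L = 1 -> mink L L1 = 0 -> mink L1 L1 = -1 ->
  mink L L2 = 1 -> mink L1 L2 = 0 ->
  L 0 0 = 0 -> L1 0 0 = 0 -> L2 0 0 = 0 ->
  f0 != 0 -> f1 ^+ 2 + g1 ^+ 2 = 1 -> f1 * f2 + g1 * g2 = 0 ->
  du z u v = f1 *: L + g1 *: e1 R -> dv z u v = f0 *: L1 ->
  duu z u v = f2 *: L + g2 *: e1 R -> duv z u v = f1 *: L1 ->
  dvv z u v = f0 *: L2 ->
  gauss_curvature z u v = - f2 / f0.
Proof.
move=> LL LL1 L1L1 LL2 L1L2 L0 L10 L20 f0n0 fg1 fg2 Hu Hv Huu Huv Hvv.
have eL : mink (e1 R) L = 0 by rewrite minkC mink_e1.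
have eL1 : mink (e1 R) L1 = 0 by rewrite minkC mink_e1.
have eL2 : mink (e1 R) L2 = 0 by rewrite minkC mink_e1.
have frameE := (minkDl, minkDr, minkZl, minkZr, mink_e1e1, LL, LL1, L1L1, LL2,
  L1L2, etrans (minkC L1 L) LL1, etrans (minkC L2 L) LL2,
  etrans (minkC L2 L1) L1L2, eL, eL1, eL2,
  etrans (minkC L _) eL, etrans (minkC L1 _) eL1, etrans (minkC L2 _) eL2).
rewrite (gauss_curvature_orthogonal (G := - f0 ^+ 2) Hu Hv Huu Huv Hvv).
- rewrite !frameE !(mulr0, mulr1, addr0, add0r).
  have -> : f2 * f1 + g2 * g1 = 0 by rewrite -[RHS]fg2; ring.
  by field.
- by rewrite !frameE -[RHS]fg1; ring.
- by rewrite !frameE; ring.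
- by rewrite !frameE; ring.
- by rewrite oppr_eq0 expf_neq0.
Qed.

Lemma smooth_on_near_derive (R : realType) (V : normedModType R) (D : set R)
    (h : R -> V) (x : R) :
  smooth_on D h -> D x -> \forall y \near x, is_derive (y : R) 1 h (derive1 h y).
Proof.
move=> hs Dx; near=> y; apply: is_derive_derive1.
by near: y; apply: filterS (hs x Dx) => y /(_ 0%N).
Unshelve. all: by end_near. Qed.

Lemma smooth_on_derive (R : realType) (V : normedModType R) (D : set R)
    (h : R -> V) (x : R) :
  smooth_on D h -> D x -> is_derive x 1 h (derive1 h x).
Proof. by move=> hs Dx; exact: nbhs_singleton (smooth_on_near_derive hs Dx). Qed.

Lemma smooth_on_derive2 (R : realType) (V : normedModType R) (D : set R)
    (h : R -> V) (x : R) :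
  smooth_on D h -> D x -> is_derive x 1 (derive1 h) (derive1 (derive1 h) x).
Proof.
move=> hs Dx; apply: is_derive_derive1.
exact: (nbhs_singleton (hs x Dx) 1%N).
Qed.

(** The relations between l, l', l'' are obtained by differentiating, along J,
    the identities that place l on the de Sitter surface and make it unit
    timelike.  The second derivatives of the parametrization require the
    formulas for z_u and z_v on a neighbourhood of u and of v, where the
    extensions of f, g and l are still differentiable. *)
Lemma meridian_curvature (R : realType) (I J : set R) (f g : R -> R)
    (l : R -> 'rV[R]_4) (u v : R) :
  meridian_surface_hyp1 I J f g l -> I u -> J v ->
  gauss_curvature (meridian_param f g l) u v = - derive1 (derive1 f) u / f u.
Proof.
move=> [ndI ndJ fs gs ls f_gt0 arc lS lt] Iu Jv.
have dl t : J t -> is_derive t 1 l (derive1 l t).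
  exact: smooth_on_derive.
have ddl t : J t -> is_derive t 1 (derive1 l) (derive1 (derive1 l) t).
  exact: smooth_on_derive2.
have LL1 t : J t -> mink (l t) (derive1 l t) = 0.
  move=> Jt; have := derive_eq_on ndJ Jt _ (is_derive_mink (dl t Jt) (dl t Jt))
    (is_derive_cst (1 : R) (t : R) 1).
  rewrite (minkC _ (l t)) => H.
  suff : mink (l t) (derive1 l t) + mink (l t) (derive1 l t) = 0 by lra.
  by apply: H => s Js; have [] := lS s Js.
have LL2 : mink (l v) (derive1 (derive1 l) v) = 1.
  have := derive_eq_on ndJ Jv LL1 (is_derive_mink (dl v Jv) (ddl v Jv))
    (is_derive_cst (0 : R) (v : R) 1).
  by rewrite (lt v Jv); lra.
have L1L2 : mink (derive1 l v) (derive1 (derive1 l) v) = 0.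
  have := derive_eq_on ndJ Jv lt (is_derive_mink (ddl v Jv) (ddl v Jv))
    (is_derive_cst (-1 : R) (v : R) 1).
  by rewrite (minkC _ (derive1 l v)); lra.
have l0 t : J t -> l t 0 0 = 0.
  move=> /lS[[a [b [c ->]]] _].
  by rewrite /e2 /e3 /e4 !mxE /= !mulr0 !addr0.
have l10 t : J t -> derive1 l t 0 0 = 0.
  move=> Jt; have /is_derive_mx/(_ 0 0) d := dl t Jt.
  exact: derive_eq_on ndJ Jt l0 d (is_derive_cst (0 : R) (t : R) 1).
have l20 : derive1 (derive1 l) v 0 0 = 0.
  have /is_derive_mx/(_ 0 0) d := ddl v Jv.
  exact: derive_eq_on ndJ Jv l10 d (is_derive_cst (0 : R) (v : R) 1).
have dfu := smooth_on_derive2 fs Iu.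
have dgu := smooth_on_derive2 gs Iu.
have fg2 : derive1 f u * derive1 (derive1 f) u +
    derive1 g u * derive1 (derive1 g) u = 0.
  have := derive_eq_on ndI Iu arc
    (is_deriveD (is_deriveX 2 dfu) (is_deriveX 2 dgu))
    (is_derive_cst (1 : R) (u : R) 1).
  rewrite /GRing.scale /= !expr1.
  move: (derive1 f u) (derive1 g u) (derive1 (derive1 f) u) => a b a'.
  by move: (derive1 (derive1 g) u) => b'; lra.
pose z := meridian_param f g l.
have duE (s : R) t :
    is_derive s 1 f (derive1 f s) -> is_derive s 1 g (derive1 g s) ->
    du z s t = derive1 f s *: l t + derive1 g s *: e1 R.
  move=> ds ds'; apply: derive1_val.
  apply: (is_derive_eq (is_deriveD (is_derive_scale ds (is_derive_cst (l t) s 1))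
    (is_derive_scale ds' (is_derive_cst (e1 R) s 1)))).
  by rewrite !scaler0 !addr0.
have linear_derive a (b : 'rV[R]_4) (h : R -> 'rV[R]_4) (s : R) dh :
    is_derive s 1 h dh -> derive1 (fun t => a *: h t + b) s = a *: dh.
  move=> hd; apply: derive1_val.
  apply: (is_derive_eq (is_deriveD (is_deriveZ a hd) (is_derive_cst b s 1))).
  by rewrite addr0.
have dvE (t : R) :
    is_derive t 1 l (derive1 l t) -> dv z u t = f u *: derive1 l t.
  exact: linear_derive.
have LL : mink (l v) (l v) = 1 by have [] := lS v Jv.
apply: (gauss_curvature_frame LL (LL1 v Jv) (lt v Jv) LL2 L1L2 (l0 v Jv)
  (l10 v Jv) l20 _ (arc u Iu) fg2 _ (dvE v (dl v Jv))).
- by rewrite gt_eqF ?f_gt0.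
- by apply: duE; exact: smooth_on_derive Iu.
- apply: derive1_val.
  apply: (@near_eq_is_derive _ _ _
    (fun s => derive1 f s *: l v + derive1 g s *: e1 R)).
    near=> s; symmetry; apply: duE; near: s; exact: smooth_on_near_derive Iu.
  apply: (is_derive_eq (is_deriveD (is_derive_scale dfu (is_derive_cst (l v) u 1))
    (is_derive_scale dgu (is_derive_cst (e1 R) u 1)))).
  by rewrite !scaler0 !addr0.
- rewrite /duv.
  under eq_fun do
    rewrite (duE _ _ (smooth_on_derive fs Iu) (smooth_on_derive gs Iu)).
  exact: linear_derive (dl v Jv).
- apply: derive1_val.
  apply: (@near_eq_is_derive _ _ _ (fun t => f u *: derive1 l t)).
    near=> t; symmetry; apply: dvE; near: t; exact: smooth_on_near_derive Jv.
  exact: is_deriveZ (ddl v Jv).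
Unshelve. all: by end_near. Qed.

(** * The equation f'' = - K f *)

(** Variation of constants: A = s f S + (f' / w) C and B = f C - (f' / w) S
    have zero derivative on I, and A S + B C = f (s S^2 + C^2) = f. *)
Lemma oscillator_solution (R : realType) (I : set R) (f f1 S C : R -> R)
    (K s w : R) :
  is_interval I -> I !=set0 ->
  (forall u, I u -> is_derive u 1 f (f1 u)) ->
  (forall u, I u -> is_derive u 1 f1 (- K * f u)) ->
  (forall u : R, is_derive u 1 S (w * C u)) ->
  (forall u : R, is_derive u 1 C (- (s * w * S u))) ->
  (forall u, s * S u ^+ 2 + C u ^+ 2 = 1) ->
  w != 0 -> K = s * w ^+ 2 ->
  exists a b, forall u, I u -> f u = a * S u + b * C u.
Proof.
move=> itvI [u0 Iu0] fd f1d Sd Cd SC w0 KE.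
pose A u := s * (f u * S u) + w^-1 * (f1 u * C u).
pose B u := f u * C u - w^-1 * (f1 u * S u).
exists (A u0), (B u0) => u Iu.
have -> : A u0 = A u.
  apply: (@derive0_const_on _ I) => // t It.
  have dt := is_deriveD (is_deriveZ s (is_deriveM (fd t It) (Sd t)))
    (is_deriveZ w^-1 (is_deriveM (f1d t It) (Cd t))).
  by apply: (is_derive_eq dt); rewrite KE /GRing.scale /=; field.
have -> : B u0 = B u.
  apply: (@derive0_const_on _ I) => // t It.
  have dt := is_deriveB (is_deriveM (fd t It) (Cd t))
    (is_deriveZ w^-1 (is_deriveM (f1d t It) (Sd t))).
  by apply: (is_derive_eq dt); rewrite KE /GRing.scale /=; field.
by rewrite -[LHS]mulr1 -(SC u) /A /B; ring.
Qed.

(** Two differentiations on I, each through [derive_eq_on] because f need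
    not agree with the combination of S and C outside I. *)
Lemma oscillator_derive2 (R : realType) (I : set R) (f f1 S C : R -> R)
    (K s w a b u f2 : R) :
  nondegenerate_interval I ->
  (forall u, I u -> is_derive u 1 f (f1 u)) -> is_derive u 1 f1 f2 ->
  (forall u : R, is_derive u 1 S (w * C u)) ->
  (forall u : R, is_derive u 1 C (- (s * w * S u))) ->
  K = s * w ^+ 2 ->
  (forall u, I u -> f u = a * S u + b * C u) -> I u -> f2 = - K * f u.
Proof.
move=> ndI fd f1d Sd Cd KE fE Iu.
have f1E t : I t -> f1 t = a * (w * C t) - b * (s * w * S t).
  move=> It; rewrite -mulrN.
  exact: derive_eq_on ndI It fE (fd t It)
    (is_deriveD (is_deriveZ a (Sd t)) (is_deriveZ b (Cd t))).
have -> : f2 = a * (w * - (s * w * S u)) - b * (s * w * (w * C u)).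
  exact: derive_eq_on ndI Iu f1E f1d
    (is_deriveB (is_deriveZ a (is_deriveZ w (Cd u)))
                (is_deriveZ b (is_deriveZ (s * w) (Sd u)))).
by rewrite fE // KE; ring.
Qed.

Lemma is_derive_rescale (R : realType) (h : R -> R) (w dh : R) (u : R) :
  is_derive (w * u) 1 h dh -> is_derive u 1 (fun t => h (w * t)) (w * dh).
Proof.
move=> hd; have wd := is_deriveZ w (is_derive_id u 1).
have d : is_derive u 1 (h \o (fun t => w * t)) _ := is_derive1_comp hd wd.
by apply: (is_derive_eq d); rewrite /GRing.scale /=; ring.
Qed.

Lemma is_derive_sinh (R : realType) (x : R) : is_derive x 1 (@sinh R) (cosh x).
Proof.
have dN := is_derive1_comp (is_derive_expR (- x)) (is_deriveNid x 1).
have d := is_deriveZ 2^-1 (is_deriveB (is_derive_expR x) dN).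
have -> : @sinh R = 2^-1 *: (expR - (expR \o -%R)).
  by apply/funext => t; rewrite /sinh fctE /GRing.scale /= mulrC.
by apply: (is_derive_eq d); rewrite /cosh /GRing.scale /=; ring.
Qed.

Lemma is_derive_cosh (R : realType) (x : R) : is_derive x 1 (@cosh R) (sinh x).
Proof.
have dN := is_derive1_comp (is_derive_expR (- x)) (is_deriveNid x 1).
have d := is_deriveZ 2^-1 (is_deriveD (is_derive_expR x) dN).
have -> : @cosh R = 2^-1 *: (expR + (expR \o -%R)).
  by apply/funext => t; rewrite /cosh fctE /GRing.scale /= mulrC.
by apply: (is_derive_eq d); rewrite /sinh /GRing.scale /=; ring.
Qed.

Lemma cosh2Bsinh2 (R : realType) (x : R) : cosh x ^+ 2 - sinh x ^+ 2 = 1.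
Proof.
rewrite /cosh /sinh expRN.
by field; rewrite gt_eqF ?expR_gt0.
Qed.

(** Reduces the two sign cases of the theorem to one pair S, C; the vacuous
    half of the conjunction disappears since K has a definite sign. *)
Lemma oscillator_basis (R : realType) (K : R) :
  K != 0 ->
  exists (S C : R -> R) (s w : R), [/\ (forall u : R, is_derive u 1 S (w * C u)),
    (forall u : R, is_derive u 1 C (- (s * w * S u))),
    (forall u, s * S u ^+ 2 + C u ^+ 2 = 1), w != 0 & K = s * w ^+ 2] /\
  forall (I : set R) (f : R -> R),
    (exists a1 a2 : R,
     (0 < K -> forall u, I u ->
        f u = a1 * sin (Num.sqrt K * u) + a2 * cos (Num.sqrt K * u)) /\
     (K < 0 -> forall u, I u ->
        f u = a1 * sinh (Num.sqrt (- K) * u) + a2 * cosh (Num.sqrt (- K) * u)))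
    <-> exists a1 a2, forall u, I u -> f u = a1 * S u + a2 * C u.
Proof.
case: (ltgtP K 0) => [Kneg|Kpos|//] _.
  set w := Num.sqrt (- K).
  exists (fun u => sinh (w * u)), (fun u => cosh (w * u)), (-1), w.
  split; first split.
  - by move=> u; exact/is_derive_rescale/is_derive_sinh.
  - move=> u; rewrite mulN1r mulNr opprK.
    exact/is_derive_rescale/is_derive_cosh.
  - by move=> u; rewrite mulN1r addrC cosh2Bsinh2.
  - by rewrite gt_eqF // sqrtr_gt0 oppr_gt0.
  - by rewrite sqr_sqrtr ?mulN1r ?opprK // oppr_ge0 ltW.
  move=> I f; split=> -[a [b]].
    by move=> [_ /(_ isT) fE]; exists a, b.
  by move=> fE; exists a, b.
set w := Num.sqrt K.
exists (fun u => sin (w * u)), (fun u => cos (w * u)), 1, w.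
split; first split.
- by move=> u; apply: (@is_derive_rescale _ (@sin R)); exact: is_derive_sin.
- move=> u; rewrite mul1r -mulrN.
  by apply: (@is_derive_rescale _ (@cos R)); exact: is_derive_cos.
- by move=> u; rewrite mul1r addrC cos2Dsin2.
- by rewrite gt_eqF // sqrtr_gt0.
- by rewrite sqr_sqrtr ?mul1r // ltW.
move=> I f; split=> -[a [b]].
  by move=> [/(_ isT) fE _]; exists a, b.
by move=> fE; exists a, b.
Qed.

(** * The sign of g' *)

(** A zero of g1 is a point where f1 = 1 or f1 = -1; f1 being strictly
    monotone, on a point interior to I this would push f1 out of [-1, 1] on one
    side.  So g1 has no interior zero, and a change of sign would produce one. *)
Lemma derivable_constant_sign (R : realType) (I : set R)
    (f1 f2 g1 g2 : R -> R) :
  is_interval I ->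
  (forall u, I u -> is_derive u 1 f1 (f2 u)) ->
  (forall u, I u -> is_derive u 1 g1 (g2 u)) ->
  (forall u, I u -> f1 u ^+ 2 + g1 u ^+ 2 = 1) ->
  (forall u, I u -> 0 < f2 u) \/ (forall u, I u -> f2 u < 0) ->
  exists eps : R, (eps = 1 \/ eps = -1) /\
    forall u, I u -> g1 u = eps * Num.sqrt (1 - f1 u ^+ 2).
Proof.
move=> itvI f1d g1d arc f2s.
(* one of f1 x, f1 y lies beyond f1 c, whose square is 1 if g1 c = 0 *)
have interior x c y : I x -> I y -> x < c < y -> g1 c != 0.
  move=> Ix Iy /andP[xc cy]; apply/eqP => gc.
  have Ic : I c by apply: (itvI x y) => //; rewrite !ltW.
  have [p [Ip _] pE] := MVT_on itvI f1d Ix Ic xc.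
  have [q [Iq _] qE] := MVT_on itvI f1d Ic Iy cy.
  have := arc c Ic; have := arc x Ix; have := arc y Iy; rewrite gc => ay ax.
  rewrite expr0n addr0 => /eqP; rewrite sqrf_eq1 => /pred2P ac1.
  have sx := sqr_ge0 (g1 x); have sy := sqr_ge0 (g1 y).
  case: f2s => f2s; have fp := f2s p Ip; have fq := f2s q Iq.
    have h1 : 0 < f1 c - f1 x by rewrite pE mulr_gt0 ?subr_gt0.
    have h2 : 0 < f1 y - f1 c by rewrite qE mulr_gt0 ?subr_gt0.
    by case: ac1 => e; rewrite e in h1 h2; nra.
  have h1 : f1 c - f1 x < 0 by rewrite pE nmulr_rlt0 ?subr_gt0.
  have h2 : f1 y - f1 c < 0 by rewrite qE nmulr_rlt0 ?subr_gt0.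
  by case: ac1 => e; rewrite e in h1 h2; nra.
have same x y : I x -> I y -> x < y -> 0 <= g1 x * g1 y.
  move=> Ix Iy xy; rewrite leNgt; apply/negP => gxy.
  have cont : {within `[x, y], continuous g1}.
    apply: derivable_within_continuous => t; rewrite in_itv => xty.
    by have [] := g1d t (itvI x y Ix Iy t xty).
  have [|c] := @IVT R g1 x y 0 (ltW xy) cont.
    rewrite ge_min le_max.
    by case: (leP (g1 x) 0) => gx; case: (leP (g1 y) 0) => gy //=; nra.
  rewrite in_itv /= => /andP[xc cy] gc.
  have cx : c != x by apply/eqP => e; move: gxy; rewrite -e gc mul0r ltxx.
  have cy' : c != y by apply/eqP => e; move: gxy; rewrite -e gc mulr0 ltxx.
  have := interior x c y Ix Iy; rewrite gc eqxx !lt_neqAle xc cy cy' eq_sym cx.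
  by move=> /(_ isT).
have gE u : I u -> Num.sqrt (1 - f1 u ^+ 2) = `|g1 u|.
  by move=> Iu; rewrite -(arc u Iu) addrAC subrr add0r sqrtr_sqr.
have [[x [Ix gx]]|nneg] := pselect (exists x, I x /\ g1 x < 0).
  exists (-1); split; first by right.
  move=> u Iu; rewrite gE // mulN1r.
  suff gu : g1 u <= 0 by rewrite ler0_norm // opprK.
  case: (ltgtP x u) => [xu|ux|<-]; last exact: ltW.
    by have := same x u Ix Iu xu; rewrite nmulr_rge0.
  by have := same u x Iu Ix ux; rewrite nmulr_lge0.
exists 1; split; first by left.
move=> u Iu; rewrite gE // mul1r ger0_norm // leNgt; apply/negP => gu.
by apply: nneg; exists u.
Qed.

(** * Surfaces of constant curvature *)

Unset Implicit Arguments.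

Theorem theorem5p3 (R : realType) (I J : set R) (f g : R -> R)
    (l : R -> 'rV[R]_4) (K : R) :
  meridian_surface_hyp1 I J f g l ->
  K != 0 ->
  (forall u v, I u -> J v ->
     gauss_curvature (meridian_param f g l) u v = K)
  <->
  (exists a1 a2 : R,
     (0 < K -> forall u, I u ->
        f u = a1 * sin (Num.sqrt K * u) + a2 * cos (Num.sqrt K * u)) /\
     (K < 0 -> forall u, I u ->
        f u = a1 * sinh (Num.sqrt (- K) * u) + a2 * cosh (Num.sqrt (- K) * u)))
  /\
  (exists eps : R, (eps = 1 \/ eps = -1) /\
     forall u, I u ->
       derive1 g u = eps * Num.sqrt (1 - derive1 f u ^+ 2)).
Proof.
move=> M K0; have [ndI ndJ fs gs _ f_gt0 arc _ _] := M.
have [itvI [x0 [_ [Ix0 _ _]]]] := ndI; have [_ [v0 [_ [Jv0 _ _]]]] := ndJ.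
have fd u : I u -> is_derive u 1 f (derive1 f u).
  exact: smooth_on_derive.
have f1d u : I u -> is_derive u 1 (derive1 f) (derive1 (derive1 f) u).
  exact: smooth_on_derive2.
have g1d u : I u -> is_derive u 1 (derive1 g) (derive1 (derive1 g) u).
  exact: smooth_on_derive2.
have [S [C [s [w [[Sd Cd SC w0 KE] solE]]]]] := oscillator_basis K0.
split=> [curv|[/solE[a [b fE]] _] u v Iu Jv]; last first.
  rewrite (meridian_curvature M Iu Jv).
  rewrite (oscillator_derive2 ndI fd (f1d u Iu) Sd Cd KE fE Iu).
  by rewrite !mulNr opprK mulfK // gt_eqF // f_gt0.
have f2E u : I u -> derive1 (derive1 f) u = - K * f u.
  move=> Iu; rewrite -(curv u v0 Iu Jv0) (meridian_curvature M Iu Jv0).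
  by rewrite !mulNr opprK divfK // gt_eqF // f_gt0.
split.
  apply/solE; apply: (oscillator_solution itvI _ fd _ Sd Cd SC w0 KE).
    by exists x0.
  by move=> u Iu; rewrite -f2E //; exact: f1d.
apply: (derivable_constant_sign itvI f1d g1d arc).
case: (ltgtP K 0) K0 => // Ks _; [left|right] => u Iu.
  by rewrite f2E // mulr_gt0 ?oppr_gt0 ?f_gt0.
by rewrite f2E // nmulr_rlt0 ?oppr_lt0 ?f_gt0.
Qed.
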